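(* The following holds: (a) if $\hat{\mathcal{Q}}$ is a monotone disaggregation of $\mathcal{Q}$, then $\mathcal{Q}$ is restrictively superadditive; (b) conversely, if $\mathcal{Q}$ is restrictively superadditive, then there exists a monotone disaggregation of $\mathcal{Q}$.
   Context: Setting. $G=(V,E)$ is a complete undirected graph with $V=\{0\}\,\dot\cup\,V_+$, where $0$ is the depot and $V_+$ is the finite set of customers. For $S\subseteq V$, $E(S)$ is the set of edges with both endpoints in $S$ and $\delta(S)$ the set of edges with exactly one endpoint in $S$ ($\delta(v)=\delta(\{v\})$). For a vector $f$ and a set $H$ of coordinates, $f(H)=\sum_{i\in H}f_i$. A route is a simple cycle through the depot, written $R=(v_1,\dots,v_\ell)$ with $\ell\ge1$ and distinct customers $v_i$, with edges $0v_1,v_1v_2,\dots,v_\ell0$ (edge $0v_1$ taken with multiplicity 2 if $\ell=1$); a sequence and its reversal are the same route. $V_+(R)=\{v_1,\dots,v_\ell\}$, and $\mathbb{1}_R\in\mathbb{Z}^E$ is the characteristic vector of the edge (multi)set of $R$. A routing plan is a set of routes whose customer sets partition $V_+$. Let $$\mathcal{X}_{\mathrm{sub}}=\{x\in[0,2]^E : x(\delta(v))=2\ \forall v\in V_+,\ x(E(S))\le|S|-1\ \forall\,\emptyset\ne S\subseteq V_+\}.$$ Integer vectors $x\in\mathcal{X}_{\mathrm{sub}}$ are in bijection with routing plans; $\mathcal{R}(x)$ denotes the unique routing plan with $x=\sum_{R\in\mathcal{R}(x)}\mathbb{1}_R$. Fix a polytope $\mathcal{X}\subseteq\mathcal{X}_{\mathrm{sub}}$.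 A recourse function $\mathcal{Q}$ (fixed) assigns to each route $R$ a value $\mathcal{Q}(R)\in\mathbb{Q}_+$. Realizable routes: $\Pi=\bigcup_{x\in\mathcal{X}\cap\mathbb{Z}^E}\mathcal{R}(x)$. A route $R'$ is a subroute of $R=(v_1,\dots,v_\ell)$, written $R'\subseteq R$, if $R'=(v_i,\dots,v_j)$ for some $1\le i\le j\le\ell$. A disaggregation of $\mathcal{Q}$ along a nonempty finite set $\Omega$ is a function $\hat{\mathcal{Q}}$ with values $\hat{\mathcal{Q}}(R,\omega)\in\mathbb{Q}_+$ for every route $R$ and $\omega\in\Omega$, such that $\mathcal{Q}(R)=\sum_{\omega\in\Omega}\hat{\mathcal{Q}}(R,\omega)$ for every $R\in\Pi$. A disaggregation $\hat{\mathcal{Q}}$ is monotone if: it is along $\Omega=V_+$; for every route $R$, $\{v\in V_+:\hat{\mathcal{Q}}(R,v)>0\}\subseteq V_+(R)$; and for every $R\in\Pi$ and $R'\subseteq R$, $\sum_{v\in V_+(R')}\hat{\mathcal{Q}}(R,v)\ge\mathcal{Q}(R')$. $\mathcal{Q}$ is restrictively superadditive if for every $R\in\Pi$, $\mathcal{Q}(R)\ge\mathcal{Q}(R_1)+\dots+\mathcal{Q}(R_t)$ for all disjoint subroutes $R_1,\dots,R_t\subseteq R$, i.e. subroutes with $V_+(R_i)\cap V_+(R_j)=\emptyset$ for $i\ne j$. *)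

(* Defs.v *)
From HB Require Import structures.
From mathcomp Require Import all_boot all_order all_algebra.

Set Implicit Arguments.
Unset Strict Implicit.
Unset Printing Implicit Defensive.

Import Order.TTheory GRing.Theory Num.Theory.
Local Open Scope ring_scope.

(* [C] is the set V_+ of customers; the vertex set is [option C], with [None]
   the depot. *)

Definition edge (C : finType) := {e : {set option C} | #|e| == 2%N}.

HB.instance Definition _ (C : finType) := SubFinite.on (edge C).

Definition inner_edges (C : finType) (S : {set option C}) : {set edge C} :=
  [set e : edge C | val e \subset S].

Definition cut_edges (C : finType) (S : {set option C}) : {set edge C} :=
  [set e : edge C | #|val e :&: S| == 1]%N.

(* Nonempty sequences of distinct customers, i.e. routes with a direction of
   travel. The length bound [#|C|] is implied by distinctness; it only serves
   to make this a finite type. *)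
Definition directed_route (C : finType) :=
  {s : #|C|.-bseq C | (0 < size s)%N && uniq s}.

HB.instance Definition _ (C : finType) := SubFinite.on (directed_route C).

Definition dseq (C : finType) (d : directed_route C) : seq C := val (val d).

Definition same_route (C : finType) : rel (directed_route C) :=
  fun d d' => (dseq d == dseq d') || (dseq d == rev (dseq d')).

Lemma same_route_refl (C : finType) : reflexive (@same_route C).
Proof. by move=> d; rewrite /same_route eqxx. Qed.

Lemma same_route_sym (C : finType) : symmetric (@same_route C).
Proof.
move=> d d'; rewrite /same_route eq_sym; congr (_ || _).
by rewrite eq_sym -(inj_eq (can_inj (@revK C))) revK.
Qed.

Lemma same_route_trans (C : finType) : transitive (@same_route C).
Proof.
move=> d2 d1 d3; rewrite /same_route.
case/orP=> /eqP-> // /orP[/eqP->|/eqP->]; first by rewrite eqxx orbT.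
by rewrite revK eqxx.
Qed.

Canonical same_route_equiv (C : finType) : equiv_rel (directed_route C) :=
  EquivRel (@same_route C) (@same_route_refl C) (@same_route_sym C)
           (@same_route_trans C).

(* A sequence and its reversal are the same route. *)
Definition route (C : finType) := {eq_quot (same_route_equiv C)}%qT.

HB.instance Definition _ (C : finType) := Choice.on (route C).
HB.instance Definition _ (C : finType) := EqQuotient.on (route C).
HB.instance Definition _ (C : finType) : isCountable (route C) :=
  CanIsCountable (@reprK _ (route C)).
HB.instance Definition _ (C : finType) : isFinite (route C) :=
  CanIsFinite (@reprK _ (route C)).

Definition undirect (C : finType) (d : directed_route C) : route C :=
  (\pi_(route C) d)%qT.

Definition customers (C : finType) (r : route C) : {set C} :=
  [set v | v \in dseq (repr r)].

(* The edges 0v_1, v_1v_2, ..., v_l0 in order of traversal; for l = 1 the edge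
   0v_1 is listed twice. *)
Definition edge_seq (C : finType) (s : seq C) : seq {set option C} :=
  pairmap (fun u w => [set u; w]) None (rcons (map Some s) None).

Definition edge_mult (C : finType) (r : route C) (e : edge C) : nat :=
  count_mem (val e) (edge_seq (dseq (repr r))).

Definition char_vec (R : pzRingType) (C : finType) (r : route C) :
  {ffun edge C -> R} := [ffun e => (edge_mult r e)%:R].

Lemma undirect_repr (C : finType) (r : route C) : undirect (repr r) = r.
Proof. exact: reprK. Qed.

Lemma eq_undirect (C : finType) (d d' : directed_route C) :
  undirect d = undirect d' <->
  dseq d = dseq d' \/ dseq d = rev (dseq d').
Proof.
rewrite /undirect; split=> [/eqP|h].
  by rewrite eqmodE /= => /orP[]/eqP; [left | right].
by apply/eqP; rewrite eqmodE /=; apply/orP; case: h => ->; rewrite eqxx; auto.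
Qed.

Lemma dseq_repr_undirect (C : finType) (d : directed_route C) :
  dseq (repr (undirect d)) = dseq d \/
  dseq (repr (undirect d)) = rev (dseq d).
Proof. by apply/eq_undirect; rewrite undirect_repr. Qed.

Lemma customers_undirect (C : finType) (d : directed_route C) :
  customers (undirect d) = [set v | v \in dseq d].
Proof.
apply/setP=> v; rewrite !inE.
by case: (dseq_repr_undirect d) => ->; rewrite ?mem_rev.
Qed.

Lemma edge_seq_rev (C : finType) (s : seq C) :
  edge_seq (rev s) = rev (edge_seq s).
Proof.
rewrite /edge_seq map_rev.
suff gen (t : seq (option C)) x y :
    pairmap (fun u w => [set u; w]) y (rcons (rev t) x)
    = rev (pairmap (fun u w => [set u; w]) x (rcons t y)) by exact: gen.
elim: t x => [|z t IH] x /=; first by rewrite setUC.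
by rewrite rev_cons -cats1 pairmap_cat IH last_rcons /= cats1 rev_cons setUC.
Qed.

Lemma edge_mult_undirect (C : finType) (d : directed_route C) (e : edge C) :
  edge_mult (undirect d) e = count_mem (val e) (edge_seq (dseq d)).
Proof.
rewrite /edge_mult; case: (dseq_repr_undirect d) => -> //.
by rewrite edge_seq_rev count_rev.
Qed.

Definition subroute (C : finType) (r' r : route C) : Prop :=
  exists d' d : directed_route C,
    [/\ undirect d' = r', undirect d = r & infix (dseq d') (dseq d)].

Definition routing_plan (C : finType) (P : {set route C}) : Prop :=
  {in P &, forall r r', r != r' -> [disjoint customers r & customers r']} /\
  \bigcup_(r in P) customers r = [set: C].

Definition in_Xsub (R : realFieldType) (C : finType) (x : {ffun edge C -> R}) :
  Prop :=
  [/\ forall e, 0 <= x e <= 2,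
      forall v : C, \sum_(e in cut_edges [set Some v]) x e = 2
    & forall S : {set C}, S != set0 ->
        \sum_(e in inner_edges (Some @: S)) x e <= #|S|%:R - 1].

(* Bounded solution set of finitely many linear inequalities. *)
Definition polytope (R : realFieldType) (I : finType) (X : {ffun I -> R} -> Prop)
  : Prop :=
  (exists (m : nat) (A : 'I_m -> I -> R) (b : 'I_m -> R),
     forall x, X x <-> forall k, \sum_i A k i * x i <= b k) /\
  (exists M : R, forall x, X x -> forall i, `|x i| <= M).

Definition integral (R : realFieldType) (I : finType) (x : {ffun I -> R}) :
  Prop := forall i, exists z : int, x i = z%:~R.

(* [decomposes x P]: P is the routing plan associated with x, which is unique
   when x is an integer vector of [in_Xsub]. *)
Definition decomposes (R : realFieldType) (C : finType)
    (x : {ffun edge C -> R}) (P : {set route C}) : Prop :=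
  routing_plan P /\ x = \sum_(r in P) char_vec R r.

Definition realizable (R : realFieldType) (C : finType)
    (X : {ffun edge C -> R} -> Prop) (r : route C) : Prop :=
  exists x, [/\ X x, integral x & exists2 P, decomposes x P & r \in P].

Definition disaggregation (R : realFieldType) (C : finType)
    (X : {ffun edge C -> R} -> Prop) (Q : route C -> rat)
    (Omega : finType) (Qh : route C -> Omega -> rat) : Prop :=
  [/\ (0 < #|Omega|)%N,
      forall r w, 0 <= Qh r w
    & forall r, realizable X r -> Q r = \sum_(w : Omega) Qh r w].

Definition monotone_disaggregation (R : realFieldType) (C : finType)
    (X : {ffun edge C -> R} -> Prop) (Q : route C -> rat)
    (Qh : route C -> C -> rat) : Prop :=
  [/\ disaggregation X Q Qh,
      forall r, [set v | 0 < Qh r v] \subset customers r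
    & forall r r', realizable X r -> subroute r' r ->
        Q r' <= \sum_(v in customers r') Qh r v].

Definition restrictively_superadditive (R : realFieldType) (C : finType)
    (X : {ffun edge C -> R} -> Prop) (Q : route C -> rat) : Prop :=
  forall r, realizable X r ->
  forall (t : nat) (rs : 'I_t -> route C),
    (forall i, subroute (rs i) r) ->
    (forall i j, i != j -> [disjoint customers (rs i) & customers (rs j)]) ->
    \sum_(i < t) Q (rs i) <= Q r.

(* Main.v *)
Require Import Defs.
From mathcomp Require Import all_boot all_order all_algebra.
Set Implicit Arguments.
Unset Strict Implicit.
Unset Printing Implicit Defensive.

Import Order.TTheory GRing.Theory Num.Theory.
Local Open Scope ring_scope.

(** Part (a) is a count: the recourse of a route is the sum of nonnegative
    customer shares, disjoint subroutes use disjoint groups of shares, and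
    monotonicity says that each group covers the recourse of its subroute
    ([sum_disjoint_le]).

    For part (b), fix a route [r] and let [F A] be the largest total recourse
    of a family of pairwise disjoint subroutes of [r] whose customers all lie
    in [A].  This set function is nondecreasing, and it is superadditive on
    disjoint sets since optimal families can be merged
    ([packing_value_superadditive]).  The share of the k-th customer of [r] is
    the increase of [F] from the set of the first k - 1 customers to the set of
    the first k.  The shares of consecutive customers telescope
    ([sum_marginal]), so the shares on a subroute [r'] add up to
    [F (A :|: customers r') - F A], with [A] the customers served before [r'].
    By superadditivity this is at least [F (customers r')], hence at least
    [Q r'].  The shares on all of [r] add up to [F (customers r)], which is at
    least [Q r] because [r] alone is a packing; restrictive superadditivity
    says exactly that it is at most [Q r].

    The same formula serves for a route that is not realizable: its shares are
    nonnegative and vanish outside the route, which is all that is required of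
    them. *)

(** * Weights of disjoint sets *)

Lemma sum_disjoint_le (K : realDomainType) (T I : finType) (A : I -> {set T})
    (g : T -> K) :
  (forall v, 0 <= g v) ->
  (forall i j, i != j -> [disjoint A i & A j]) ->
  \sum_i \sum_(v in A i) g v <= \sum_v g v.
Proof.
move=> g_ge0 disjA.
rewrite -partition_disjoint_bigcup //.
by rewrite [leRHS](bigID (mem (\bigcup_i A i))) /= lerDl sumr_ge0.
Qed.

(** * Packings *)

Definition packing {T I : finType} (A : I -> {set T}) (D : {set I})
    (B : {set T}) (P : {set I}) : bool :=
  [&& P \subset D, [forall i in P, A i \subset B] &
      [forall i in P, forall j in P, (i != j) ==> [disjoint A i & A j]]].

Definition packing_value {K : realDomainType} {T I : finType}
    (A : I -> {set T}) (w : I -> K) (D : {set I}) (B : {set T}) : K :=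
  \sum_(i in [arg max_(P > set0 | packing A D B P) \sum_(i in P) w i]%O) w i.

Lemma packingP (T I : finType) (A : I -> {set T}) (D : {set I}) (B : {set T})
    (P : {set I}) :
  reflect [/\ {subset P <= D}, {in P, forall i, A i \subset B} &
              {in P &, forall i j, i != j -> [disjoint A i & A j]}]
          (packing A D B P).
Proof.
apply: (iffP and3P) => [[/subsetP sPD /forall_inP sAB /forall_inP disjA]|].
  split=> // i j Pi Pj; apply/implyP.
  by have /forall_inP := disjA i Pi; apply.
move=> [sPD sAB disjA]; split; [exact/subsetP | exact/forall_inP |].
apply/forall_inP => i Pi; apply/forall_inP => j Pj; apply/implyP.
exact: disjA.
Qed.

Lemma packing_set0 (T I : finType) (A : I -> {set T}) (D : {set I})
    (B : {set T}) : packing A D B set0.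
Proof. by apply/packingP; split=> [i|i|i j]; rewrite inE. Qed.

Lemma packing_value_max (K : realDomainType) (T I : finType)
    (A : I -> {set T}) (w : I -> K) (D : {set I}) (B : {set T}) (P : {set I}) :
  packing A D B P -> \sum_(i in P) w i <= packing_value A w D B.
Proof.
rewrite /packing_value; case: arg_maxP; first exact: packing_set0.
by move=> P0 _ maxP0 /maxP0.
Qed.

Lemma packing_value_attained (K : realDomainType) (T I : finType)
    (A : I -> {set T}) (w : I -> K) (D : {set I}) (B : {set T}) :
  exists2 P, packing A D B P & packing_value A w D B = \sum_(i in P) w i.
Proof.
rewrite /packing_value; case: arg_maxP; first exact: packing_set0.
by move=> P packP _; exists P.
Qed.

Lemma packing_value_ge0 (K : realDomainType) (T I : finType)
    (A : I -> {set T}) (w : I -> K) (D : {set I}) (B : {set T}) :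
  0 <= packing_value A w D B.
Proof.
have := packing_value_max w (packing_set0 A D B).
by rewrite big_set0.
Qed.

Lemma packing_value_mono (K : realDomainType) (T I : finType)
    (A : I -> {set T}) (w : I -> K) (D : {set I}) (B B' : {set T}) :
  B \subset B' -> packing_value A w D B <= packing_value A w D B'.
Proof.
move=> sBB'; have [P /packingP[sPD sAB disjA] ->] :=
  packing_value_attained A w D B.
apply: packing_value_max; apply/packingP; split=> // i /sAB sAiB.
exact: subset_trans sBB'.
Qed.

Lemma packing_value_ge (K : realDomainType) (T I : finType)
    (A : I -> {set T}) (w : I -> K) (D : {set I}) (i : I) :
  i \in D -> w i <= packing_value A w D (A i).
Proof.
move=> Di; have <- : \sum_(j in [set i]) w j = w i by rewrite big_set1.
apply: packing_value_max.
apply/packingP; split=> [j /set1P-> | j /set1P-> | j k /set1P-> /set1P->] //.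
by rewrite eqxx.
Qed.

(** Optimal packings of two disjoint sets together pack their union.  As the
    packed sets are nonempty, no index occurs in both packings, so nothing is
    counted only once in the union. *)
Lemma packing_value_superadditive (K : realDomainType) (T I : finType)
    (A : I -> {set T}) (w : I -> K) (D : {set I}) (B B' : {set T}) :
  (forall i, A i != set0) -> [disjoint B & B'] ->
  packing_value A w D B + packing_value A w D B'
    <= packing_value A w D (B :|: B').
Proof.
move=> A_neq0 disjB.
have [P /packingP[sPD sAB disjP] ->] := packing_value_attained A w D B.
have [P' /packingP[sPD' sAB' disjP'] ->] := packing_value_attained A w D B'.
have cross i j : i \in P -> j \in P' -> [disjoint A i & A j].
  by move=> /sAB sAi /sAB' sAj; apply: disjointWl sAi (disjointWr sAj disjB).
have disjPP' : [disjoint P & P'].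
  apply/pred0P => i /=; apply/negP => /andP[Pi Pi'].
  have := cross i i Pi Pi'.
  by rewrite -setI_eq0 setIid (negPf (A_neq0 i)).
have <- : \sum_(i in P :|: P') w i = \sum_(i in P) w i + \sum_(i in P') w i.
  by rewrite -bigU //; apply: eq_bigl => i; rewrite !inE.
apply: packing_value_max; apply/packingP; split.
- by move=> i /setUP[/sPD|/sPD'].
- move=> i /setUP[/sAB sAi|/sAB' sAi]; apply: subset_trans sAi _.
    exact: subsetUl.
  exact: subsetUr.
- move=> i j /setUP[Pi|Pi] /setUP[Pj|Pj] neq_ij.
  + exact: disjP.
  + exact: cross.
  + by rewrite disjoint_sym; apply: cross.
  + exact: disjP'.
Qed.

(** * Increments of a set function along a sequence *)

Definition marginal {K : zmodType} {T : finType} (F : {set T} -> K) (s : seq T)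
    (v : T) : K :=
  F [set x in take (index v s).+1 s] - F [set x in take (index v s) s].

(** For an absent element both prefixes are the whole sequence. *)
Lemma marginal_notin (K : zmodType) (T : finType) (F : {set T} -> K)
    (s : seq T) (v : T) : v \notin s -> marginal F s v = 0.
Proof.
by move=> /memNindex idx_v; rewrite /marginal idx_v !take_oversize ?subrr.
Qed.

Lemma marginal_ge0 (K : realDomainType) (T : finType) (F : {set T} -> K)
    (s : seq T) (v : T) :
  (forall A B : {set T}, A \subset B -> F A <= F B) -> 0 <= marginal F s v.
Proof.
move=> F_mono; rewrite subr_ge0; apply: F_mono; apply/subsetP => x.
by rewrite !inE; apply: mem_subseq; rewrite -{1}(take_takel s (leqnSn _))
  take_subseq.
Qed.

Lemma sum_marginal (K : zmodType) (T : finType) (F : {set T} -> K)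
    (p t u : seq T) :
  uniq (p ++ t ++ u) ->
  \sum_(v <- t) marginal F (p ++ t ++ u) v
    = F [set x in p ++ t] - F [set x in p].
Proof.
elim: t p => [|a t IHt] p uniq_s; first by rewrite big_nil cats0 subrr.
have a_p : a \notin p.
  by move: uniq_s; rewrite cat_uniq /= negb_or => /and3P[_ /andP[]].
have := IHt (rcons p a); rewrite !cat_rcons => /(_ uniq_s) sum_t.
rewrite big_cons sum_t /marginal index_cat (negPf a_p) /= eqxx addn0.
rewrite -cat_rcons take_size_cat ?size_rcons // cat_rcons take_size_cat //.
by rewrite addrC addrA subrK.
Qed.

(** * Subroutes *)

Lemma dseq_uniq (C : finType) (d : directed_route C) : uniq (dseq d).
Proof. by case/andP: (valP d). Qed.

Lemma customers_neq0 (C : finType) (r : route C) : customers r != set0.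
Proof.
have /andP[] := valP (repr r); rewrite -/(dseq _).
case def_s: (dseq (repr r)) => [//|a s] _ _.
by apply/set0Pn; exists a; rewrite inE def_s mem_head.
Qed.

Definition subroutes {C : finType} (r : route C) : {set route C} :=
  [set r' | [exists d', exists d,
     [&& undirect d' == r', undirect d == r & infix (dseq d') (dseq d)]]].

Lemma subroutesP (C : finType) (r r' : route C) :
  reflect (subroute r' r) (r' \in subroutes r).
Proof.
rewrite inE; apply: (iffP existsP) => [[d' /existsP[d /and3P[]]]|].
  by move=> /eqP def_r' /eqP def_r inf; exists d', d.
by move=> [d' [d [def_r' def_r inf]]]; exists d'; apply/existsP; exists d;
  rewrite def_r' def_r !eqxx.
Qed.

Lemma subroute_refl (C : finType) (r : route C) : subroute r r.
Proof. by exists (repr r), (repr r); rewrite undirect_repr infix_refl. Qed.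

(** Whatever directions witness that [r'] is a subroute of [r], reversing both
    if necessary exhibits the customers of [r'] as a contiguous block of the
    chosen representative of [r]. *)
Lemma subroute_block (C : finType) (r r' : route C) :
  subroute r' r ->
  exists p t u, dseq (repr r) = p ++ t ++ u /\ customers r' = [set v in t].
Proof.
move=> [d' [d [<- <- inf]]]; rewrite customers_undirect.
case: (dseq_repr_undirect d) => ->; last rewrite -infix_rev in inf;
  have /infixP[p [u ->]] := inf; first by exists p, (dseq d'), u.
exists p, (rev (dseq d')), u; split=> //.
by apply/setP => v; rewrite !inE mem_rev.
Qed.

(** * Shares of the customers *)

Definition share {C : finType} (Q : route C -> rat) (r : route C) (v : C) :
    rat :=
  marginal (packing_value (@customers C) Q (subroutes r)) (dseq (repr r)) v.

Lemma sum_share_block (C : finType) (Q : route C -> rat) (r : route C)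
    (p t u : seq C) :
  dseq (repr r) = p ++ t ++ u ->
  packing_value (@customers C) Q (subroutes r) [set v in t]
    <= \sum_(v in [set v in t]) share Q r v.
Proof.
move=> def_s; have uniq_s := dseq_uniq (repr r); rewrite def_s in uniq_s.
have /and3P[_ dis uniq_tu] :
    [&& uniq p, ~~ has (mem p) (t ++ u) & uniq (t ++ u)].
  by rewrite -cat_uniq.
have uniq_t : uniq t by move: uniq_tu; rewrite cat_uniq => /andP[].
rewrite (eq_bigl (mem t)) => [|v]; last by rewrite inE.
rewrite -big_uniq //= /share def_s sum_marginal // lerBrDl.
have -> : [set x in p ++ t] = [set x in p] :|: [set x in t].
  by apply/setP => x; rewrite !inE mem_cat.
apply: packing_value_superadditive; first exact: customers_neq0.
apply/pred0P => x; rewrite /= !inE; apply/negP => /andP[p_x t_x].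
by case/hasP: dis; exists x; rewrite // mem_cat t_x.
Qed.

Lemma sum_share_le (C : finType) (Q : route C -> rat) (r : route C) :
  \sum_v share Q r v
    <= packing_value (@customers C) Q (subroutes r) (customers r).
Proof.
set s := dseq (repr r).
rewrite (bigID (mem s)) /= [X in _ + X]big1 => [|v v_notin]; last first.
  exact: marginal_notin.
rewrite addr0 -big_uniq ?dseq_uniq //= /share -/s.
have := @sum_marginal _ _ (packing_value (@customers C) Q (subroutes r))
  [::] s [::].
rewrite /= cats0 => ->; last exact: dseq_uniq.
by rewrite gerBl packing_value_ge0.
Qed.

(** Restrictive superadditivity says that no packing by subroutes beats the
    route itself. *)
Lemma packing_value_realizable (R : realFieldType) (C : finType)
    (X : {ffun edge C -> R} -> Prop) (Q : route C -> rat) (r : route C) :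
  restrictively_superadditive X Q -> realizable X r ->
  packing_value (@customers C) Q (subroutes r) (customers r) <= Q r.
Proof.
move=> supQ real_r.
have [P /packingP[subP _ disjP] ->] :=
  packing_value_attained (@customers C) Q (subroutes r) (customers r).
rewrite big_enum_val; apply: (supQ r real_r) => [i|i j neq_ij].
  exact/subroutesP/subP/enum_valP.
by apply: disjP; rewrite ?enum_valP // (inj_eq enum_val_inj).
Qed.

Theorem theorem3 (R : realFieldType) (C : finType) (C_gt0 : (0 < #|C|)%N)
    (X : {ffun edge C -> R} -> Prop) (X_polytope : polytope X)
    (X_sub : forall x, X x -> in_Xsub x)
    (Q : route C -> rat) (Q_ge0 : forall r, 0 <= Q r) :
  (forall Qh : route C -> C -> rat,
     monotone_disaggregation X Q Qh -> restrictively_superadditive X Q) /\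
  (restrictively_superadditive X Q ->
     exists Qh : route C -> C -> rat, monotone_disaggregation X Q Qh).
Proof.
split=> [Qh [[_ Qh_ge0 sumQh] _ monoQh] r real_r t rs sub_rs disj_rs | supQ].
  rewrite sumQh //.
  apply: le_trans (sum_disjoint_le (Qh_ge0 r) disj_rs).
  by apply: ler_sum => i _; apply: monoQh.
have share_ge0 r v : 0 <= share Q r v.
  by apply: marginal_ge0 => A B; apply: packing_value_mono.
have share_mono r r' :
    subroute r' r -> Q r' <= \sum_(v in customers r') share Q r v.
  move=> sub_r'; have [p [t [u [def_s def_r']]]] := subroute_block sub_r'.
  rewrite def_r'; apply: le_trans (sum_share_block Q def_s); rewrite -def_r'.
  exact/packing_value_ge/subroutesP.
exists (share Q); split=> [|r|r r' _]; last exact: share_mono.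
  split=> // r real_r; apply/eqP; rewrite eq_le; apply/andP; split.
    apply: le_trans (share_mono r r (subroute_refl r)) _.
    by rewrite [leRHS](bigID (mem (customers r))) /= lerDl sumr_ge0.
  exact: le_trans (sum_share_le Q r) (packing_value_realizable supQ real_r).
apply/subsetP => v; rewrite !inE; apply: contraLR => v_notin.
by rewrite /share marginal_notin // ltxx.
Qed.
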